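(* Let $(V_h,\mathrm{d})$ be a family of subcomplexes of the domain complex $(V,\mathrm{d})$ of a closed Hilbert complex $(W,\mathrm{d})$, parametrized by $h$ and admitting uniformly $V$-bounded cochain projections $\pi_h\colon V\to V_h$. Let $F\colon V^k\to W^k$ be monotone and Lipschitz with respect to the $V$-norm, and let $f\in W^k$. Let $(\sigma,u,p)\in V^{k-1}\times V^k\times\mathfrak{H}^k$ be the solution of $$\begin{aligned}\langle\sigma,\tau\rangle-\langle u,\mathrm{d}\tau\rangle&=0&&\forall\tau\in V^{k-1},\\ \langle\mathrm{d}\sigma,v\rangle+\langle\mathrm{d}u,\mathrm{d}v\rangle+\langle p,v\rangle+\langle F(u+p),v\rangle&=\langle f,v\rangle&&\forall v\in V^k,\\ \langle u,q\rangle&=0&&\forall q\in\mathfrak{H}^k,\end{aligned}$$ and let $(\sigma_h,u_h,p_h)\in V_h^{k-1}\times V_h^k\times\mathfrak{H}_h^k$ be the solution of $$\begin{aligned}\langle\sigma_h,\tau\rangle-\langle u_h,\mathrm{d}\tau\rangle&=0&&\forall\tau\in V_h^{k-1},\\ \langle\mathrm{d}\sigma_h,v\rangle+\langle\mathrm{d}u_h,\mathrm{d}v\rangle+\langle p_h,v\rangle+\langle F(u_h+p_h),v\rangle&=\langle f,v\rangle&&\forall v\in V_h^k,\\ \langle u_h,q\rangle&=0&&\forall q\in\mathfrak{H}_h^k.\end{aligned}$$ Then $$\|\sigma-\sigma_h\|_V+\|u-u_h\|_V+\|p-p_h\|\le C\Bigl(\inf_{\tau\in V_h^{k-1}}\|\sigma-\tau\|_V+\inf_{v\in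 V_h^k}\|u-v\|_V+\inf_{q\in V_h^k}\|p-q\|_V+\mu\inf_{v\in V_h^k}\|P_{\mathfrak{B}}u-v\|_V\Bigr),$$ where $$\mu=\mu_h^k=\sup_{r\in\mathfrak{H}^k,\ \|r\|=1}\|(I-\pi_h^k)r\|,$$ and where the constant $C$ depends only on the Poincaré constant $c_P$ and the Lipschitz constant of $F$.
   Context: All Hilbert spaces are real. A Hilbert complex $(W,\mathrm{d})$ is a sequence of Hilbert spaces $W^k$ with closed, densely defined linear maps $\mathrm{d}^k\colon V^k\subset W^k\to V^{k+1}\subset W^{k+1}$ (possibly unbounded) such that $\mathrm{d}^k\circ\mathrm{d}^{k-1}=0$. It is closed if each image $\mathrm{d}^kV^k$ is closed in $W^{k+1}$. The inner product and norm of $W^k$ are written $\langle\cdot,\cdot\rangle$, $\|\cdot\|$. The domain complex $(V,\mathrm{d})$ consists of the domains $V^k$ with the graph inner product $\langle u,v\rangle_V=\langle u,v\rangle+\langle\mathrm{d}^ku,\mathrm{d}^kv\rangle$ and norm $\|\cdot\|_V$. Degree indices on $\mathrm{d}$ are suppressed. Put $\mathfrak{Z}^k=\ker\mathrm{d}^k$, $\mathfrak{B}^k=\mathrm{d}^{k-1}V^{k-1}$, $\mathfrak{H}^k=\mathfrak{Z}^k\cap\mathfrak{B}^{k\perp}$ (harmonic space); $P_{\mathfrak{B}}$ is the $W$-orthogonal projection onto $\mathfrak{B}^k$. The Poincaré constant $c_P$ is a constant such that $\|v\|_V\le c_P\|\mathrm{d}^jv\|$ for all $v\in V^j$ orthogonal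 to $\mathfrak{Z}^j$, for the relevant degrees $j$. A subcomplex $V_h\subset V$ consists of Hilbert subspaces $V_h^j\subset V^j$ (in practice finite-dimensional) with $\mathrm{d}V_h^j\subset V_h^{j+1}$. A $V$-bounded cochain projection $\pi_h\colon V\to V_h$ is a family of $V$-bounded linear, surjective, idempotent maps $\pi_h^j\colon V^j\to V_h^j$ with $\mathrm{d}\pi_h^j=\pi_h^{j+1}\mathrm{d}$; uniformly $V$-bounded means their $V$-operator norms are bounded independently of $h$. The discrete harmonic space is $\mathfrak{H}_h^k=\{z\in V_h^k:\mathrm{d}z=0,\ z\perp\mathrm{d}V_h^{k-1}\}$, where $\perp$ is with respect to $\langle\cdot,\cdot\rangle$. $F\colon V^k\to W^k$ is monotone if $\langle Fu-Fv,u-v\rangle\ge0$ for all $u,v\in V^k$, and Lipschitz with respect to the $V$-norm if there is a constant $C_F$ (Lipschitz constant) with $\|Fu-Fv\|\le C_F\|u-v\|_V$ for all $u,v\in V^k$. Under these assumptions both mixed problems have unique solutions.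
   Formalization: The constant C depends on the uniform bound of the V-operator norms of the projections (in degrees k-1 and k) as well as on the Poincaré constant and the Lipschitz constant of F; independence of that bound, as literally claimed, fails already for F=0 in finite dimensions. *)

(* Defs.v *)
From HB Require Import structures.
From mathcomp Require Import all_boot all_order all_algebra sesquilinear.
From mathcomp Require Import all_classical all_reals.
From mathcomp Require Import topology normedtype.

Set Implicit Arguments.
Unset Strict Implicit.
Unset Printing Implicit Defensive.
Import Order.TTheory GRing.Theory Num.Theory.
Import numFieldNormedType.Exports.
Local Open Scope classical_set_scope.
Local Open Scope ring_scope.

HB.mixin Record CompleteNormedModule_isHilbert (R : realType) (U : Type)
    of CompleteNormedModule R U := {
  inner : {dot U for (@idfun R)} ;
  inner_norm : forall u : U, inner u u = `|u| ^+ 2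
}.

#[short(type="hilbertType")]
HB.structure Definition Hilbert (R : realType) :=
  {U of CompleteNormedModule_isHilbert R U & CompleteNormedModule R U}.

Notation "''[' u , v ]" := (inner u v) : ring_scope.

Definition linear_on (R : realType) (U U' : lmodType R) (A : set U)
    (g : U -> U') : Prop :=
  forall (a : R) (u v : U), A u -> A v -> g (a *: u + v) = a *: g u + g v.

(* A partially defined operator is a total function of which only the values
   on [dom] are ever used. *)
Record closed_operator (R : realType) (U U' : hilbertType R) := ClosedOperator {
  dom : set U ;
  opfun :> U -> U' ;
  dom_submod : submod_closed [in dom] ;
  dom_dense : dense dom ;
  op_linear : linear_on dom opfun ;
  op_closed : closed [set x : U * U' | dom x.1 /\ x.2 = opfun x.1]
}.

(* Complexes are indexed by the integers; complexes indexed by the natural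
   numbers or by a finite range are extended by zero spaces. *)
Record hilbert_complex (R : realType) := HilbertComplex {
  cspace :> int -> hilbertType R ;
  diff : forall k : int, closed_operator (cspace k) (cspace (k + 1)) ;
  diff_dom : forall k u, dom (diff k) u -> dom (diff (k + 1)) (diff k u) ;
  diff_diff : forall k u, dom (diff k) u -> diff (k + 1) (diff k u) = 0
}.

Notation "''d' u" := (diff _ _ u)
  (at level 10, u at level 9, format "''d'  u") : ring_scope.

Section HilbertComplex.
Variables (R : realType) (W : hilbert_complex R).

Definition V (k : int) : set (W k) := dom (diff W k).
Arguments V k : clear implicits.

Definition Vinner (k : int) (u v : W k) : R := '[u, v] + '['d u, 'd v].

Definition Vnorm (k : int) (u : W k) : R := Num.sqrt (Vinner u u).

Definition cycles (k : int) : set (W k) := [set u | V k u /\ 'd u = 0].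
Arguments cycles k : clear implicits.

(* [boundaries k] and [harmonic k] live in degree [k + 1], so that the degree
   of the target of ['d] is matched definitionally. *)
Definition boundaries (k : int) : set (W (k + 1)) := diff W k @` V k.
Arguments boundaries k : clear implicits.

Definition closed_complex : Prop := forall k : int, closed (boundaries k).

Definition harmonic (k : int) : set (W (k + 1)) :=
  [set z | cycles (k + 1) z /\ forall b, boundaries k b -> '[z, b] = 0].
Arguments harmonic k : clear implicits.

Definition poincare_constant (k : int) (c : R) : Prop :=
  forall v : W k, V k v -> (forall z : W k, cycles k z -> '[v, z] = 0) ->
    Vnorm v <= c * `|'d v|.

Record subcomplex := Subcomplex {
  subspace_of :> forall k : int, set (W k) ;
  sub_dom : forall k, @subspace_of k `<=` V k ;
  sub_submod : forall k, submod_closed [in @subspace_of k] ;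
  (* closed in [V k] for the graph norm *)
  sub_closed : forall k (v : W k), V k v ->
    (forall e : R, 0 < e -> exists2 w, @subspace_of k w & Vnorm (v - w) < e) ->
    @subspace_of k v ;
  sub_diff : forall k (u : W k), @subspace_of k u -> @subspace_of (k + 1) ('d u)
}.

Definition discrete_harmonic (Vh : subcomplex) (k : int) : set (W (k + 1)) :=
  [set z | [/\ Vh (k + 1) z, 'd z = 0 &
     forall t : W k, Vh k t -> '[z, 'd t] = 0]].
Arguments discrete_harmonic Vh k : clear implicits.

Definition Vbounded_by (k : int) (g : W k -> W k) (M : R) : Prop :=
  forall v : W k, V k v -> Vnorm (g v) <= M * Vnorm v.

Record cochain_projection (Vh : subcomplex) := CochainProjection {
  proj :> forall k : int, W k -> W k ;
  proj_linear : forall k, linear_on (V k) (@proj k) ;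
  proj_bounded : forall k, exists M : R, Vbounded_by (@proj k) M ;
  proj_sub : forall k (u : W k), V k u -> Vh k (proj u) ;
  proj_surj : forall k (v : W k), Vh k v -> exists2 u, V k u & proj u = v ;
  proj_idem : forall k (u : W k), V k u -> proj (proj u) = proj u ;
  proj_diff : forall k (u : W k), V k u -> 'd (proj u) = proj ('d u)
}.

Definition Vmonotone (k : int) (F : W k -> W k) : Prop :=
  forall u v : W k, V k u -> V k v -> 0 <= '[F u - F v, u - v].

Definition Vlipschitz (k : int) (F : W k -> W k) (CF : R) : Prop :=
  forall u v : W k, V k u -> V k v -> `|F u - F v| <= CF * Vnorm (u - v).

(* The mixed problem posed on the spaces S (degree k), X and H (degree k + 1). *)
Definition mixed_solution (k : int) (S : set (W k)) (X H : set (W (k + 1)))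
    (F : W (k + 1) -> W (k + 1)) (f : W (k + 1))
    (s : W k) (u p : W (k + 1)) : Prop :=
  [/\ S s, X u & H p] /\
  [/\ forall t : W k, S t -> '[s, t] - '[u, 'd t] = 0,
      forall v : W (k + 1), X v ->
        '['d s, v] + '['d u, 'd v] + '[p, v] + '[F (u + p), v] = '[f, v] &
      forall q : W (k + 1), H q -> '[u, q] = 0].

(* Orthogonal projection of [u] onto [A]; it exists and is unique when [A] is
   a closed subspace. *)
Definition orth_proj (k : int) (A : set (W k)) (u : W k) : W k :=
  xget 0 [set b | A b /\ forall a, A a -> '[u - b, a] = 0].

Definition Vdist (k : int) (u : W k) (A : set (W k)) : R :=
  inf [set Vnorm (u - v) | v in A].

(* [sup set0 = 0], so this is 0 when the harmonic space is trivial. *)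
Definition mu (Vh : subcomplex) (pi : cochain_projection Vh) (k : int) : R :=
  sup [set `|r - pi (k + 1) r| | r in [set r | harmonic k r /\ `|r| = 1]].

End HilbertComplex.

Arguments V {R} W k.
Arguments cycles {R} W k.
Arguments boundaries {R} W k.
Arguments harmonic {R} W k.
Arguments discrete_harmonic {R W} Vh k.

(* Main.v *)
(* The discrete problem is compared with an arbitrary admissible triple
   (t, v, q), v orthogonal to and q in the discrete harmonic space.  Testing the
   difference of the two systems with (uh - v) + (ph - q), monotonicity discards
   F(uh + ph) - F(v + q), and what is left bounds sh - t, d(uh - v) and ph - q
   once d(sh - t) has been bounded by testing with itself; the discrete Poincare
   inequality, inherited through the cochain projection, bounds uh - v.
   It remains to make v and q admissible.  Subtracting from v its discrete
   harmonic part costs sup <u, r> over unit discrete harmonic r; since r is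
   within mu of the harmonic space, to which both u and the boundaries are
   orthogonal, this is at most mu times the error of the cochain projection
   on P_B u.  For q one takes the discrete harmonic part of the cochain
   projection of p. *)

Require Import Defs.
From mathcomp Require Import all_boot all_order all_algebra.
From mathcomp Require Import all_classical all_reals topology normedtype.
From mathcomp Require Import sesquilinear ring lra.
Import Order.TTheory GRing.Theory Num.Theory.
Import numFieldNormedType.Exports.
Local Open Scope classical_set_scope.
Local Open Scope ring_scope.

Set Implicit Arguments.
Unset Strict Implicit.
Unset Printing Implicit Defensive.

(** * Inner products and orthogonal projection in a real Hilbert space *)

Section InnerProduct.
Variables (R : realType) (U : hilbertType R).
Implicit Types (x y z : U) (A : set U).

Lemma innerC x y : '[x, y] = '[y, x].
Proof. by rewrite (hermC (inner : {dot U for idfun})) expr0 mul1r. Qed.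

Lemma innerDl x y z : '[x + y, z] = '[x, z] + '[y, z].
Proof. exact: linearDl. Qed.

Lemma innerDr x y z : '[x, y + z] = '[x, y] + '[x, z].
Proof. exact: linearDr. Qed.

Lemma innerBl x y z : '[x - y, z] = '[x, z] - '[y, z].
Proof. exact: linearBl. Qed.

Lemma innerBr x y z : '[x, y - z] = '[x, y] - '[x, z].
Proof. exact: linearBr. Qed.

Lemma innerZl a x y : '[a *: x, y] = a * '[x, y].
Proof. by rewrite linearZl_LR. Qed.

Lemma innerZr a x y : '[x, a *: y] = a * '[x, y].
Proof. by rewrite innerC innerZl innerC. Qed.

Lemma innerNr x y : '[x, - y] = - '[x, y].
Proof. exact: linearNr. Qed.

Lemma inner0l x : '[0, x] = 0. Proof. exact: linear0l. Qed.

Lemma inner0r x : '[x, 0] = 0. Proof. exact: linear0r. Qed.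

Lemma Cauchy_Schwarz x y : `|'[x, y]| <= `|x| * `|y|.
Proof.
have [->|y0] := eqVneq y 0; first by rewrite inner0r !normr0 mulr0.
have yy : 0 < `|y| ^+ 2 by rewrite exprn_gt0 // normr_gt0.
have : 0 <= `| `|y| ^+ 2 *: x - '[x, y] *: y| ^+ 2 by exact: sqr_ge0.
rewrite -inner_norm innerBl !innerBr !innerZl !innerZr !inner_norm (innerC y x).
rewrite [X in 0 <= X](_ : _ = `|y| ^+ 2 * ((`|x| * `|y|) ^+ 2 - '[x, y] ^+ 2)).
  rewrite pmulr_rge0 // subr_ge0 => h.
  by rewrite -ler_sqr ?nnegrE ?mulr_ge0 ?normr_ge0 // real_normK ?num_real.
by ring.
Qed.

Lemma inner_le x y : '[x, y] <= `|x| * `|y|.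
Proof. exact: le_trans (ler_norm _) (Cauchy_Schwarz x y). Qed.

Lemma inner_le_bound x y c : `|x| <= c -> '[x, y] <= c * `|y|.
Proof. by move=> xc; apply: le_trans (inner_le x y) _; rewrite ler_wpM2r. Qed.

Lemma innerN_le_bound x y c : `|x| <= c -> - '[x, y] <= c * `|y|.
Proof. by rewrite -innerNr -[in c * _]normrN; exact: inner_le_bound. Qed.

Lemma pythagoras x y : '[x, y] = 0 -> `|x + y| ^+ 2 = `|x| ^+ 2 + `|y| ^+ 2.
Proof.
move=> xy; rewrite -!inner_norm innerDl !innerDr xy (innerC y) xy.
by rewrite addr0 add0r.
Qed.

Lemma norm_le_orthogonal x y : '[x, y] = 0 -> `|x| <= `|x + y|.
Proof.
move=> xy; rewrite -(@ler_pXn2r _ 2) ?nnegrE // pythagoras // lerDl.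
exact: sqr_ge0.
Qed.

(** Turns an estimate obtained by testing with [x] itself into a bound on [|x|]. *)
Lemma norm_le_of_sqr x c : `|x| ^+ 2 <= c * `|x| -> 0 <= c -> `|x| <= c.
Proof.
have [->|x0] := eqVneq x 0; first by rewrite normr0.
by rewrite expr2 ler_pM2r // normr_gt0.
Qed.

Section Submodule.
Variables (A : set U) (submodA : submod_closed [in A]).

Lemma submod0 : A 0.
Proof. by case: submodA => + _; rewrite in_setE. Qed.

Lemma submodP a x y : A x -> A y -> A (a *: x + y).
Proof.
case: submodA => _ h Ax Ay; have := h a x y.
by rewrite !in_setE; apply.
Qed.

Lemma submodD x y : A x -> A y -> A (x + y).
Proof. by rewrite -{2}[x]scale1r; exact: submodP. Qed.

Lemma submodZ a x : A x -> A (a *: x).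
Proof.
by rewrite -[a *: x]addr0 => Ax; apply: submodP => //; exact: submod0.
Qed.

Lemma submodB x y : A x -> A y -> A (x - y).
Proof. by move=> Ax Ay; rewrite addrC -scaleN1r; exact: submodP. Qed.

(** The near-minimizers of the distance from [x] to [A] generate a Cauchy filter; its limit stays in
    the closed set [A] and minimizes the distance, and the error of a minimizer is orthogonal to [A]
    by a first variation. *)
Lemma exists_projection : closed A -> forall x,
  exists2 b, A b & forall a, A a -> '[x - b, a] = 0.
Proof.
move=> clA x.
pose E := [set `|x - a| ^+ 2 | a in A]; pose d := inf E.
have E0 : E !=set0 by exists (`|x - 0| ^+ 2), 0 => //; exact: submod0.
have lE : has_lbound E by exists 0 => _ [a _ <-]; exact: sqr_ge0.
have dP a : A a -> d <= `|x - a| ^+ 2.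
  by move=> Aa; apply: ge_inf => //; exists a.
pose B (e : R) := [set a | A a /\ `|x - a| ^+ 2 < d + e].
pose F := filter_from [set e : R | 0 < e] B.
have FF : Filter F.
  apply: filter_from_filter; first by exists 1 => /=.
  move=> i j /= i0 j0; exists (Num.min i j); first by rewrite lt_min i0.
  by move=> a [Aa]; rewrite -ltrBlDl lt_min !ltrBlDl => /andP[? ?].
have PF : ProperFilter F.
  apply: filter_from_proper => e /= e0.
  have [_ [a Aa <-] lt] := inf_adherent e0 (conj E0 lE).
  by exists a.
(* The midpoint of [a] and [b] lies in [A], so its squared distance to [x] is at least [d]; the
   parallelogram law does the rest. *)
have Bdist e a b : B e a -> B e b -> `|a - b| ^+ 2 < 4 * e.
  move=> [Aa la] [Ab lb].
  have := dP (2^-1 *: (a + b)) (submodZ _ (submodD Aa Ab)).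
  have -> : x - 2^-1 *: (a + b) = 2^-1 *: ((x - a) + (x - b)).
    have n2 : (2 : R) != 0 by rewrite pnatr_eq0.
    apply: (scalerI n2); rewrite scalerBr !scalerA mulfV // !scale1r.
    by rewrite scaler_nat mulr2n opprD addrACA.
  have -> : a - b = (x - b) - (x - a) by rewrite opprB [RHS]addrC addrA subrK.
  move: la lb; rewrite -!inner_norm innerZl innerZr.
  move: (x - a) (x - b) => y z.
  rewrite innerBl !innerBr innerDl !innerDr (innerC z y); lra.
have : cauchy_ex F.
  move=> e e0; have e1 : 0 < e ^+ 2 / 4 by rewrite divr_gt0 ?exprn_gt0.
  have [_ [a Aa <-] la] := inf_adherent e1 (conj E0 lE).
  exists a; exists (e ^+ 2 / 4) => // b Bb.
  rewrite -ball_normE /=.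
  have := Bdist _ _ _ (conj Aa la) Bb.
  by rewrite mulrCA mulfV ?pnatr_eq0 // mulr1 ltr_pXn2r ?nnegrE ?(ltW e0).
move=> /cauchy_exP /cauchy_cvgP /cvg_ex [b Fb].
have Ab : A b.
  apply: (@closed_cvg _ _ F _ id) Fb => //.
  by exists 1 => //= a [].
have bd : `|x - b| ^+ 2 <= d.
  apply/ler_addgt0Pr => e e0.
  have de : 0 <= d + e.
    apply: addr_ge0 (ltW e0); apply: lb_le_inf => // _ [a _ <-].
    exact: sqr_ge0.
  rewrite -[leRHS]sqr_sqrtr // ler_pXn2r ?nnegrE ?sqrtr_ge0 //.
  have : `|x - a| @[a --> F] --> `|x - b|.
    by apply: cvg_norm; apply: cvgB Fb; exact: cvg_cst.
  apply: (closed_cvg _ (@closed_le _ (Num.sqrt (d + e)))).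
  exists e => // a [_ /ltW la] /=.
  by rewrite -(@ler_pXn2r _ 2) ?nnegrE ?sqrtr_ge0 // sqr_sqrtr.
exists b => // a Aa.
(* The best multiple of [a] would have denominator [|a| ^+ 2]; the added 1 covers [a = 0] and still
   forces the square of ['[x - b, a]] to vanish. *)
have := le_trans bd (dP _ (submodP ('[x - b, a] / (`|a| ^+ 2 + 1)) Aa Ab)).
rewrite [_ + b]addrC opprD addrA -!inner_norm.
move: (x - b) => y; rewrite innerBl !innerBr !innerZl !innerZr (innerC a y).
have : 0 <= '[a, a] by rewrite inner_norm sqr_ge0.
move: '[y, a] '[a, a] '[y, y] => w n m n0 h.
have n1 : n + 1 != 0 by rewrite gt_eqF // ltr_wpDl.
apply/eqP; rewrite -sqrf_eq0 eq_le sqr_ge0 andbT.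
have : w ^+ 2 * (n + 2) / (n + 1) ^+ 2 <= 0.
  rewrite -subr_le0 in h; apply: le_trans h.
  by rewrite le_eqVlt; apply/orP; left; apply/eqP; field; rewrite n1.
rewrite pmulr_lle0; first by rewrite pmulr_lle0 // ltr_wpDl.
by rewrite invr_gt0 exprn_gt0 // ltr_wpDl.
Qed.

End Submodule.
End InnerProduct.

Lemma submod_closed_set (R : realType) (U : hilbertType R) (A : set U) :
  A 0 -> (forall (a : R) x y, A x -> A y -> A (a *: x + y)) ->
  submod_closed [in A].
Proof.
move=> A0 AD; split; first by rewrite in_setE.
by move=> a x y; rewrite !in_setE; exact: AD.
Qed.

(** * Graph norm, cycles and boundaries of a Hilbert complex *)

Section Complex.
Variables (R : realType) (W : hilbert_complex R).

Lemma V_submod k : submod_closed [in V W k].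
Proof. exact: dom_submod. Qed.

Lemma diffP k a (u v : W k) : V W k u -> V W k v ->
  'd (a *: u + v) = a *: 'd u + 'd v.
Proof. exact: op_linear. Qed.

Lemma diffB k (u v : W k) : V W k u -> V W k v -> 'd (u - v) = 'd u - 'd v.
Proof.
move=> Vu Vv; have -> : u - v = -1 *: v + u by rewrite scaleN1r [RHS]addrC.
by rewrite diffP // scaleN1r [LHS]addrC.
Qed.

Lemma diffD k (u v : W k) : V W k u -> V W k v -> 'd (u + v) = 'd u + 'd v.
Proof. by move=> Vu Vv; rewrite -[u in LHS]scale1r diffP // scale1r. Qed.

Lemma diff0 k : 'd (0 : W k) = 0.
Proof. by rewrite -(subrr 0) diffB ?subrr //; exact: submod0 (V_submod k). Qed.

Lemma diffN k (u : W k) : V W k u -> 'd (- u) = - 'd u.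
Proof.
move=> Vu; rewrite -[in LHS]sub0r diffB ?diff0 ?sub0r //.
exact: (submod0 (V_submod k)).
Qed.

Lemma Vnorm_ge0 k (u : W k) : 0 <= Vnorm u.
Proof. exact: sqrtr_ge0. Qed.

Lemma Vnorm_sqr k (u : W k) : Vnorm u ^+ 2 = `|u| ^+ 2 + `|'d u| ^+ 2.
Proof.
by rewrite /Vnorm /Vinner !inner_norm sqr_sqrtr // addr_ge0 ?sqr_ge0.
Qed.

Lemma norm_le_Vnorm k (u : W k) : `|u| <= Vnorm u.
Proof.
rewrite -(@ler_pXn2r _ 2) ?nnegrE ?Vnorm_ge0 // Vnorm_sqr.
by rewrite lerDl sqr_ge0.
Qed.

Lemma diff_le_Vnorm k (u : W k) : `|'d u| <= Vnorm u.
Proof.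
rewrite -(@ler_pXn2r _ 2) ?nnegrE ?Vnorm_ge0 // Vnorm_sqr.
by rewrite lerDr sqr_ge0.
Qed.

Lemma Vnorm_le k (u : W k) : Vnorm u <= `|u| + `|'d u|.
Proof.
rewrite -(@ler_pXn2r _ 2) ?nnegrE ?Vnorm_ge0 ?addr_ge0 // Vnorm_sqr sqrrD.
by rewrite -addrA addrCA lerDr mulrn_wge0 // mulr_ge0.
Qed.

Lemma Vnorm_cycle k (u : W k) : 'd u = 0 -> Vnorm u = `|u|.
Proof.
move=> du; apply/eqP; rewrite eq_le norm_le_Vnorm andbT.
by apply: le_trans (Vnorm_le u) _; rewrite du normr0 addr0.
Qed.

Lemma cycles_submod k : submod_closed [in cycles W k].
Proof.
apply: submod_closed_set => [|a x y [Vx dx] [Vy dy]].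
  by split; [exact: submod0 (V_submod k) | exact: diff0].
split; first exact: (submodP (V_submod k) _ Vx Vy).
by rewrite diffP // dx dy scaler0 addr0.
Qed.

(** The cycles are the preimage of the closed graph of ['d] under [u |-> (u, 0)]. *)
Lemma cycles_closed k : closed (cycles W k).
Proof.
have -> : cycles W k = (fun u : W k => (u, 0 : W (k + 1))) @^-1`
    [set x | dom (diff W k) x.1 /\ x.2 = 'd x.1].
  by apply/seteqP; split=> u [Vu du]; split.
apply: preimage_closed; last exact: op_closed.
move=> u _; apply: cvg_pair; [exact: cvg_id | exact: cvg_cst].
Qed.

Lemma boundaries_submod k : submod_closed [in boundaries W k].
Proof.
apply: submod_closed_set => [|a _ _ [u Vu <-] [v Vv <-]].
  by exists 0; [exact: submod0 (V_submod k) | exact: diff0].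
by exists (a *: u + v); [exact: (submodP (V_submod k) _ Vu Vv) | exact: diffP].
Qed.

Lemma boundary_cycle k : boundaries W k `<=` cycles W (k + 1).
Proof. by move=> _ [u Vu <-]; split; [exact: diff_dom | exact: diff_diff]. Qed.

(** Closed boundaries guarantee that [xget] returns a true projection and not its default value
    0. *)
Lemma orth_projP k : closed (boundaries W k) -> forall u : W (k + 1),
  boundaries W k (orth_proj (boundaries W k) u) /\
  forall a, boundaries W k a -> '[u - orth_proj (boundaries W k) u, a] = 0.
Proof.
move=> clB u.
have [b Bb ub] := exists_projection (boundaries_submod k) clB u.
exact: (@xgetPex _ 0 [set b | boundaries W k b /\
  forall a, boundaries W k a -> '[u - b, a] = 0]) (ex_intro _ b (conj Bb ub)).
Qed.

(** * Discrete cycles and boundaries, and the discrete Poincare inequality *)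

Section Subcomplex.
Variable Vh : subcomplex W.

Definition discrete_cycles k : set (W k) := Vh k `&` cycles W k.
Definition discrete_boundaries k : set (W (k + 1)) := diff W k @` Vh k.

Lemma Vh_submod k : submod_closed [in Vh k].
Proof. exact: sub_submod. Qed.

Lemma Vh_V k (v : W k) : Vh k v -> V W k v.
Proof. exact: sub_dom. Qed.

Lemma discrete_cycles_submod k : submod_closed [in @discrete_cycles k].
Proof.
apply: submod_closed_set => [|a x y [Vx Zx] [Vy Zy]].
  by split; [exact: submod0 (Vh_submod k) | exact: submod0 (cycles_submod k)].
split; first exact: (submodP (Vh_submod k) _ Vx Vy).
exact: (submodP (cycles_submod k) _ Zx Zy).
Qed.

(** On differences of cycles the graph norm is the norm of [W], so a [W]-limit of discrete cycles is
    a graph-norm limit and [sub_closed] applies. *)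
Lemma discrete_cycles_closed k : closed (@discrete_cycles k).
Proof.
move=> z clz.
have [Vz dz] : cycles W k z.
  by apply: cycles_closed; apply: closureS clz => x [].
split=> //; apply: sub_closed => // e e0.
have [w [[Vw [VVw dw]] zw]] := clz _ (nbhsx_ballx z e e0).
exists w => //; rewrite Vnorm_cycle; first by rewrite -ball_normE in zw.
by rewrite diffB // dz dw subrr.
Qed.

Lemma discrete_boundaries_submod k : submod_closed [in @discrete_boundaries k].
Proof.
apply: submod_closed_set => [|a _ _ [u Vu <-] [v Vv <-]].
  by exists 0; [exact: submod0 (Vh_submod k) | exact: diff0].
exists (a *: u + v); first exact: (submodP (Vh_submod k) _ Vu Vv).
by apply: diffP; exact: Vh_V.
Qed.

Lemma discrete_boundary_cycle k :
  @discrete_boundaries k `<=` @discrete_cycles (k + 1).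
Proof.
move=> _ [u Vu <-]; split; first exact: sub_diff.
by apply: boundary_cycle; exists u => //; exact: Vh_V.
Qed.

Variable Ph : cochain_projection Vh.

Lemma proj_id k (v : W k) : Vh k v -> Ph k v = v.
Proof. by move=> /(proj_surj Ph) [u Vu <-]; exact: proj_idem. Qed.

Lemma projB k (u v : W k) : V W k u -> V W k v ->
  Ph k (u - v) = Ph k u - Ph k v.
Proof.
move=> Vu Vv; have -> : u - v = -1 *: v + u by rewrite scaleN1r [RHS]addrC.
by rewrite proj_linear // scaleN1r [LHS]addrC.
Qed.

Lemma proj_boundary k (b : W (k + 1)) : boundaries W k b ->
  discrete_boundaries (Ph (k + 1) b).
Proof.
move=> [t Vt <-]; rewrite -proj_diff //.
by exists (Ph k t) => //; exact: proj_sub.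
Qed.

(** A boundary lying in [Vh] is fixed by [Ph], and [Ph], commuting with ['d], sends boundaries to
    discrete boundaries. Closedness of the discrete boundaries follows. *)
Lemma discrete_boundariesE k :
  @discrete_boundaries k = boundaries W k `&` @discrete_cycles (k + 1).
Proof.
apply/seteqP; split=> [b Bb|b [Bb [Vb _]]].
  by split; [case: Bb => u /Vh_V; exists u | exact: discrete_boundary_cycle].
by rewrite -(proj_id Vb); exact: proj_boundary.
Qed.

Lemma discrete_boundaries_closed k :
  closed (boundaries W k) -> closed (@discrete_boundaries k).
Proof.
move=> clB; rewrite discrete_boundariesE.
exact: closedI clB (@discrete_cycles_closed _).
Qed.

(** [Ph] fixes [w], so [x] and [x - w] have the same projection error. *)
Lemma proj_error M k (x w : W k) : Vbounded_by (Ph k) M -> V W k x -> Vh k w ->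
  `|x - Ph k x| <= (1 + `|M|) * Vnorm (x - w).
Proof.
move=> bPh Vx Vw; have VVw := Vh_V Vw.
have Vxw : V W k (x - w) by exact: (submodB (V_submod k) Vx VVw).
have -> : x - Ph k x = (x - w) - Ph k (x - w).
  by rewrite projB // (proj_id Vw) opprB addrA subrK.
apply: le_trans (ler_normB _ _) _; rewrite mulrDl mul1r.
apply: lerD (norm_le_Vnorm _) _; apply: le_trans (norm_le_Vnorm _) _.
apply: le_trans (bPh _ Vxw) _.
by rewrite ler_wpM2r ?Vnorm_ge0 // ler_norm.
Qed.

(** Let [z] be the part of [v] orthogonal to all cycles, which the continuous inequality bounds by
    ['d v]. Since [Ph z] has the same differential as [v], the difference [v - Ph z] is a discrete
    cycle, hence orthogonal to [v]; so [|v| <= |Ph z|], and boundedness of [Ph] concludes. *)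
Lemma discrete_poincare M cP k (v : W k) :
  Vbounded_by (Ph k) M -> poincare_constant W k cP ->
  Vh k v -> (forall z, @discrete_cycles k z -> '[v, z] = 0) ->
  `|v| <= `|M| * `|cP| * `|'d v|.
Proof.
move=> bPh hP Vv vZ; have VVv := Vh_V Vv.
have [b Zb zZ] := exists_projection (cycles_submod k) (@cycles_closed k) v.
have Vz : V W k (v - b) by exact: (submodB (V_submod k) VVv Zb.1).
have dz : 'd (v - b) = 'd v by rewrite diffB ?Zb.2 ?subr0 //; exact: Zb.1.
move: (v - b) zZ Vz dz => z zZ Vz dz.
have VPz := proj_sub Ph Vz.
have dPz : 'd (Ph k z) = 'd v.
  by rewrite proj_diff // dz proj_id //; exact: sub_diff.
have vPz : '[v, v] = '[v, Ph k z].
  apply/eqP; rewrite -subr_eq0 -innerBr vZ //.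
  split; first exact: (submodB (Vh_submod k) Vv VPz).
  split; first exact: (submodB (V_submod k) VVv (Vh_V VPz)).
  by rewrite diffB ?dPz ?subrr //; exact: Vh_V.
have : `|v| <= `|Ph k z|.
  by apply: norm_le_of_sqr => //; rewrite -inner_norm vPz mulrC inner_le.
move=> /le_trans; apply; apply: le_trans (norm_le_Vnorm _) _.
apply: le_trans (bPh _ Vz) _; rewrite -mulrA.
apply: le_trans (ler_wpM2r (Vnorm_ge0 _) (ler_norm M)) _.
rewrite ler_wpM2l //; apply: le_trans (hP _ Vz zZ) _.
by rewrite dz ler_wpM2r // ler_norm.
Qed.

(** * Harmonic against discrete harmonic elements *)

Lemma harmonic_submod k : submod_closed [in harmonic W k].
Proof.
apply: submod_closed_set => [|a x y [Zx xB] [Zy yB]].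
  by split=> [|b _]; [exact: submod0 (cycles_submod _) | exact: inner0l].
split=> [|b Bb]; first exact: (submodP (cycles_submod _) _ Zx Zy).
by rewrite innerDl innerZl xB // yB // mulr0 addr0.
Qed.

(** Comparison with the discrete element 0 gives the bound; it ensures that the supremum [mu]
    dominates every member of the set. *)
Lemma mu_has_ubound M k : Vbounded_by (Ph (k + 1)) M ->
  has_ubound [set `|r - Ph (k + 1) r| |
    r in [set r | harmonic W k r /\ `|r| = 1]].
Proof.
move=> bPh; exists (1 + `|M|) => _ [r [[[Vr dr] _] r1] <-].
have := proj_error bPh Vr (submod0 (Vh_submod _)).
by rewrite subr0 Vnorm_cycle // r1 mulr1.
Qed.

Lemma mu_ge0 M k : Vbounded_by (Ph (k + 1)) M -> 0 <= mu Ph k.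
Proof.
move=> bPh; rewrite /mu; set E := (X in sup X).
have [[x Ex]|/set0P/negP/negPn/eqP ->] := pselect (E !=set0);
  last by rewrite sup0.
apply: le_trans (ub_le_sup (mu_has_ubound bPh) Ex).
by case: Ex => r _ <-.
Qed.

Lemma proj_harmonic M k (r : W (k + 1)) : Vbounded_by (Ph (k + 1)) M ->
  harmonic W k r -> `|r - Ph (k + 1) r| <= mu Ph k * `|r|.
Proof.
move=> bPh Hr; have Vr := Hr.1.1.
have Ph0 : Ph (k + 1) 0 = 0 by apply: proj_id; exact: submod0 (Vh_submod _).
have [->|r0] := eqVneq r 0; first by rewrite Ph0 subr0 !normr0 mulr0.
rewrite -ler_pdivrMr ?normr_gt0 //.
apply: ub_le_sup; first exact: mu_has_ubound bPh.
exists (`|r|^-1 *: r).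
  split; first exact: (submodZ (harmonic_submod k) _ Hr).
  by rewrite normrZ normfV normr_id mulVf ?normr_eq0.
have -> : Ph (k + 1) (`|r|^-1 *: r) = `|r|^-1 *: Ph (k + 1) r.
  rewrite -[_ *: r]addr0 proj_linear ?Ph0 ?addr0 //.
  exact: submod0 (V_submod _).
by rewrite -scalerBr normrZ normfV normr_id mulrC.
Qed.

Lemma discrete_harmonic_boundary k (q b : W (k + 1)) :
  discrete_harmonic Vh k q -> discrete_boundaries b -> '[q, b] = 0.
Proof. by move=> [_ _ qB] [t Vt <-]; exact: qB. Qed.

(** Take [b] the projection of [q] onto the boundaries and [r = q - b]. The discrete boundary [Ph b]
    is orthogonal to [q] and to [r], hence to [b], so [|b| <= |Ph b - b|]. As [Ph q = q], the right
    side is the projection error of [r], at most [mu] times [|r| <= |q|]. *)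
Lemma discrete_harmonic_gap M k (q : W (k + 1)) :
  closed (boundaries W k) -> Vbounded_by (Ph (k + 1)) M ->
  discrete_harmonic Vh k q ->
  exists r, [/\ harmonic W k r, boundaries W k (q - r) &
    `|q - r| <= mu Ph k * `|q|].
Proof.
move=> clB bPh Hq; have [Vq dq _] := Hq.
have [b Bb rB] := exists_projection (boundaries_submod k) clB q.
have [Vb db] := boundary_cycle Bb.
have Hr : harmonic W k (q - b).
  split=> //; split; last by rewrite diffB ?dq ?db ?subr0 //; exact: Vh_V.
  exact: (submodB (V_submod _) (Vh_V Vq) Vb).
exists (q - b); rewrite subKr; split=> //.
have Pb := proj_boundary Bb.
have bPb : '[b, Ph (k + 1) b] = 0.
  rewrite -[b in '[b, _]](subKr q) innerBl (discrete_harmonic_boundary Hq) //.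
  rewrite rB ?subr0 //.
  by move: Pb; rewrite discrete_boundariesE => -[].
have rq : `|q - b| <= `|q|.
  by have := norm_le_orthogonal (rB _ Bb); rewrite subrK.
apply: le_trans (ler_wpM2l (mu_ge0 bPh) rq).
apply: le_trans (proj_harmonic bPh Hr).
rewrite projB //; last exact: Vh_V.
have -> : q - b - (Ph (k + 1) q - Ph (k + 1) b) = Ph (k + 1) b - b.
  by rewrite (proj_id Vq) opprB [LHS]addrC subrKA.
apply: norm_le_of_sqr => //.
rewrite distrC mulrC; apply: le_trans (inner_le _ _).
by rewrite innerBr bPb subr0 inner_norm.
Qed.

(** Only the boundary part [q - r] of [q] meets [u], and there [u] may be replaced by its projection
    [x]. Subtracting [Ph x], orthogonal to [q] and to [r], leaves the projection error of [x] times
    the gap of [q]. *)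
Lemma inner_discrete_harmonic M k (u q w : W (k + 1)) :
  closed (boundaries W k) -> Vbounded_by (Ph (k + 1)) M ->
  (forall r, harmonic W k r -> '[u, r] = 0) ->
  discrete_harmonic Vh k q -> Vh (k + 1) w ->
  '[u, q] <= (1 + `|M|) *
    (mu Ph k * Vnorm (orth_proj (boundaries W k) u - w)) * `|q|.
Proof.
move=> clB bPh uH Hq Vw.
have [r [Hr Bb gap]] := discrete_harmonic_gap clB bPh Hq.
have [Bx ux] := orth_projP clB u.
move: (orth_proj _ u) Bx ux => x Bx ux.
have Px := proj_boundary Bx.
have BPx : boundaries W k (Ph (k + 1) x).
  by move: Px; rewrite discrete_boundariesE => -[].
have -> : '[u, q] = '[x - Ph (k + 1) x, q - r].
  have Pq : '[Ph (k + 1) x, q - r] = 0.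
    rewrite innerBr innerC (discrete_harmonic_boundary Hq) // innerC Hr.2 //.
    by rewrite subrr.
  have xq : '[u - x, q - r] = 0 by exact: ux.
  move/eqP: xq; rewrite innerBl subr_eq0 innerBl Pq subr0 => /eqP <-.
  by rewrite innerBr (uH _ Hr) subr0.
apply: le_trans (inner_le _ _) _.
have Vx := (boundary_cycle Bx).1.
apply: le_trans (ler_pM _ _ (proj_error bPh Vx Vw) gap) _ => //.
by rewrite le_eqVlt; apply/orP; left; apply/eqP; ring.
Qed.

(** Removing from [Ph p] its discrete boundary part [b] does not increase the error: [b] is
    orthogonal to both [p] and [q], so Pythagoras compares [p - q] with [p - Ph p]. *)
Lemma discrete_harmonic_approx M k (p w : W (k + 1)) :
  closed (boundaries W k) -> Vbounded_by (Ph (k + 1)) M ->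
  harmonic W k p -> Vh (k + 1) w ->
  exists2 q, discrete_harmonic Vh k q & `|p - q| <= (1 + `|M|) * Vnorm (p - w).
Proof.
move=> clB bPh [[Vp dp] pB] Vw; have VPp := proj_sub Ph Vp.
have clBh := discrete_boundaries_closed clB.
have [b Bb qB] :=
  exists_projection (@discrete_boundaries_submod k) clBh (Ph (k + 1) p).
have [Vb [VVb db]] := discrete_boundary_cycle Bb.
exists (Ph (k + 1) p - b).
  split=> [||t Vt]; first exact: (submodB (Vh_submod _) VPp Vb).
    rewrite diffB ?db ?subr0 ?proj_diff ?dp //; last exact: Vh_V.
    by apply: proj_id; exact: submod0 (Vh_submod _).
  by apply: qB; exists t.
apply: le_trans (proj_error bPh Vp Vw).
have -> : p - Ph (k + 1) p = p - (Ph (k + 1) p - b) + (- b).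
  by rewrite opprB addrA addrAC addrK.
apply: norm_le_orthogonal.
rewrite innerNr innerBl qB // subr0 pB ?oppr0 //.
by move: Bb; rewrite discrete_boundariesE => -[].
Qed.

End Subcomplex.
End Complex.

(** * Real inequalities closing the energy estimate, and passage to infima *)

Lemma le_linear_of_sqr_le (R : realFieldType) (K D X : R) :
  0 <= K -> 0 <= D -> X ^+ 2 <= K * D * (X + D) -> X <= (K + 1) * D.
Proof.
move=> K0 D0 h; rewrite leNgt; apply/negP => lt.
have KD : 0 <= K * D by exact: mulr_ge0.
have KDD : 0 <= K * D * D by exact: mulr_ge0.
have X0 : 0 < X by apply: le_lt_trans lt; rewrite mulr_ge0 ?addr_ge0.
have XD : D <= X by lra.
have l1 : 0 < X * (X - (K + 1) * D) by rewrite mulr_gt0 // subr_gt0.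
have l2 : 0 <= D * (X - (K + 1) * D) by rewrite mulr_ge0 // subr_ge0 ltW.
have DD : 0 <= D * D by exact: mulr_ge0.
nra.
Qed.

(** The 3 comes from [(S + T + P) ^+ 2 <= 3 * (S ^+ 2 + T ^+ 2 + P ^+ 2)]; the summands bound
    [S + T], [G] and [(1 + 2 * L) * (Y + P)] by multiples of [S + T + P + D]. *)
Definition energy_const (R : pzRingType) (c L : R) : R :=
  3 * (1 + (1 + L * (c + 3)) + (1 + 2 * L) * (c + 2)).

(** The first 2 pays for the triangle inequalities; the product bounds [S + G + Y + T + P] through
    [S + T + P + D <= (energy_const c L + 2) * D]. *)
Definition stability_const (R : pzRingType) (c L : R) : R :=
  2 + (2 + c + (1 + L * (c + 3))) * (energy_const c L + 2).

(* Used with S = |sh - t|, T = |d(uh - v)|, P = |ph - q|, Y = |uh - v|,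
   G = |d(sh - t)|, D the approximation error, c the discrete Poincare constant
   and L the Lipschitz constant. *)
Lemma energy_closure (R : realFieldType) (c L D S T P Y G : R) :
  0 <= c -> 0 <= L -> 0 <= D -> 0 <= S -> 0 <= T -> 0 <= P ->
  Y <= c * T + c * (S + D) + D ->
  G <= D + L * (2 * D + Y + T + P) ->
  S ^+ 2 + T ^+ 2 + P ^+ 2 <= D * (S + G + T + (1 + 2 * L) * (Y + P)) ->
  2 * D + (S + G + Y + T + P) <= stability_const c L * D.
Proof.
move=> c0 L0 D0 S0 T0 P0 hY hG hE.
pose X := S + T + P; have X0 : 0 <= X by rewrite !addr_ge0.
have cP : 0 <= c * P by exact: mulr_ge0.
have hY' : Y <= (c + 1) * (X + D) by rewrite /X; lra.
have hG' : G <= (1 + L * (c + 3)) * (X + D).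
  apply: le_trans hG _.
  have : L * (2 * D + Y + T + P) <= L * ((c + 3) * (X + D)).
    by apply: ler_wpM2l => //; rewrite /X in hY' *; lra.
  by rewrite /X; lra.
have hYP : (1 + 2 * L) * (Y + P) <= (1 + 2 * L) * ((c + 2) * (X + D)).
  by apply: ler_wpM2l; rewrite /X in hY' *; lra.
have K0 : 0 <= energy_const c L.
  by rewrite /energy_const !(mulr_ge0, addr_ge0).
have hX : X <= (energy_const c L + 1) * D.
  apply: le_linear_of_sqr_le => //.
  have hX3 : X ^+ 2 <= 3 * (S ^+ 2 + T ^+ 2 + P ^+ 2).
    have := sqr_ge0 (S - T); have := sqr_ge0 (S - P); have := sqr_ge0 (T - P).
    by rewrite /X; nra.
  apply: le_trans hX3 _.
  have : D * (S + G + T + (1 + 2 * L) * (Y + P)) <=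
         D * ((1 + (1 + L * (c + 3)) + (1 + 2 * L) * (c + 2)) * (X + D)).
    by apply: ler_wpM2l => //; rewrite /X in hG' hYP *; lra.
  by rewrite /energy_const; lra.
have hXD : (2 + c + (1 + L * (c + 3))) * (X + D) <=
    (2 + c + (1 + L * (c + 3))) * ((energy_const c L + 2) * D).
  by apply: ler_wpM2l; [rewrite !(mulr_ge0, addr_ge0) | lra].
by rewrite /stability_const; rewrite /X in hX hY' hG' hXD *; lra.
Qed.

Lemma stability_const_ge0 (R : realFieldType) (c L : R) :
  0 <= c -> 0 <= L -> 0 <= stability_const c L.
Proof.
move=> c0 L0.
by rewrite /stability_const /energy_const !(mulr_ge0, addr_ge0).
Qed.

(** For [C = 0], where one cannot divide by [C], any element of the nonempty [A] gives the claim. *)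
Lemma le_Vdist (R : realType) (W : hilbert_complex R) k (u : W k)
    (A : set (W k)) (X Y C : R) : A !=set0 -> 0 <= C ->
  (forall v, A v -> X <= Y + C * Vnorm (u - v)) -> X <= Y + C * Vdist u A.
Proof.
move=> [v0 Av0]; rewrite le_eqVlt => /orP[/eqP<- h|C0 h].
  by have := h _ Av0; rewrite !mul0r.
rewrite -lerBlDl -ler_pdivrMl //; apply: lb_le_inf.
  by exists (Vnorm (u - v0)), v0.
by move=> _ [v Av <-]; rewrite ler_pdivrMl // lerBlDl; exact: h.
Qed.

(** * Discrete Hodge decomposition and the bound for coclosed elements *)

Section Stability.
Variables (R : realType) (W : hilbert_complex R) (k : int).
Variables (Vh : subcomplex W) (Ph : cochain_projection Vh) (M cP : R).
Hypothesis clB : closed (boundaries W k).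
Hypothesis bPh : Vbounded_by (Ph k) M.
Hypothesis bPh1 : Vbounded_by (Ph (k + 1)) M.
Hypothesis poinc : poincare_constant W k cP.
Hypothesis poinc1 : poincare_constant W (k + 1) cP.

Lemma discrete_harmonic_cycle q :
  discrete_harmonic Vh k q -> discrete_cycles Vh q.
Proof. by move=> [Vq dq _]; split=> //; split=> //; exact: sub_dom Vq. Qed.

(** With [z] and [b] the projections of [y] onto the discrete cycles and boundaries, [z - b] is the
    discrete harmonic part. *)
Lemma discrete_hodge (y : W (k + 1)) :
  exists b h, [/\ discrete_boundaries Vh b, discrete_harmonic Vh k h &
    forall z, discrete_cycles Vh z -> '[y - (b + h), z] = 0].
Proof.
have [b Bb yB] := exists_projection (discrete_boundaries_submod Vh k)
  (discrete_boundaries_closed Ph clB) y.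
have [z Zz yZ] := exists_projection (discrete_cycles_submod Vh (k + 1))
  (@discrete_cycles_closed _ _ Vh _) y.
exists b, (z - b); split=> // [|w Zw]; last by rewrite (addrC b) subrK yZ.
have Zb := discrete_boundary_cycle Bb.
have [Vzb [_ dzb]] := submodB (discrete_cycles_submod Vh (k + 1)) Zz Zb.
split=> // t Vt; have Bt : discrete_boundaries Vh ('d t) by exists t.
have -> : z - b = (y - b) - (y - z) by rewrite opprB [RHS]addrC addrA subrK.
by rewrite innerBl yB // yZ ?subrr //; exact: discrete_boundary_cycle.
Qed.

(* ['d t] is the projection of [y] onto the discrete boundaries. *)
Lemma discrete_coclosed_bound (y : W (k + 1)) : Vh (k + 1) y ->
  (forall q, discrete_harmonic Vh k q -> '[y, q] = 0) ->
  exists t, [/\ Vh k t, `|t| <= `|M| * `|cP| * `|'d t|,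
    '[y, 'd t] = `|'d t| ^+ 2 &
    `|y| <= `|M| * `|cP| * `|'d y| + `|'d t|].
Proof.
move=> Vy yH; have [b [h [Bb Hh yZ]]] := discrete_hodge y.
have h0 : h = 0.
  have := yZ _ (discrete_harmonic_cycle Hh).
  rewrite innerBl yH // innerDl (innerC b) (discrete_harmonic_boundary Hh) //.
  rewrite !add0r => /eqP; rewrite oppr_eq0 inner_norm sqrf_eq0 normr_eq0.
  by move/eqP.
rewrite {}h0 addr0 {h Hh} in yZ.
have [Vb [VVb db]] := discrete_boundary_cycle Bb.
have Vyb := submodB (Vh_submod Vh (k + 1)) Vy Vb.
have dyb : 'd (y - b) = 'd y by rewrite diffB ?db ?subr0 //; exact: sub_dom Vy.
have hyb := discrete_poincare bPh1 poinc1 Vyb yZ.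
have yb : '[y, b] = `|b| ^+ 2.
  have : '[y - b, b] = 0 by exact: yZ.
  by rewrite innerBl inner_norm => /eqP; rewrite subr_eq0 => /eqP.
have hy : `|y| <= `|M| * `|cP| * `|'d y| + `|b|.
  rewrite -dyb -{1}(subrK b y); apply: le_trans (ler_normD _ _) _.
  by rewrite lerD2r.
case: Bb yb hy => t Vt <- yb hy.
(* Removing the discrete cycle part of [t] keeps ['d t] and makes the discrete Poincare inequality
   applicable. *)
have [z [Vz [VVz dz]] tZ] := exists_projection
  (discrete_cycles_submod Vh k) (@discrete_cycles_closed _ _ Vh k) t.
have dtz : 'd (t - z) = 'd t by rewrite diffB ?dz ?subr0 //; exact: sub_dom Vt.
exists (t - z); rewrite dtz; split=> //.
  exact: (submodB (Vh_submod Vh k) Vt Vz).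
rewrite -dtz; apply: (discrete_poincare bPh poinc) => //.
exact: (submodB (Vh_submod Vh k) Vt Vz).
Qed.

(** * Comparison of the continuous and discrete mixed problems *)

Variables (CF : R) (F : W (k + 1) -> W (k + 1)) (f : W (k + 1)).
Hypothesis monoF : Vmonotone F.
Hypothesis lipF : Vlipschitz F CF.
Variables (s : W k) (u p : W (k + 1)) (sh : W k) (uh ph : W (k + 1)).
Hypothesis sol : mixed_solution (V W k) (V W (k + 1)) (harmonic W k) F f s u p.
Hypothesis solh : mixed_solution (Vh k) (Vh (k + 1)) (discrete_harmonic Vh k)
  F f sh uh ph.

Lemma quasi_optimal_constrained (t : W k) (v q : W (k + 1)) :
  Vh k t -> Vh (k + 1) v ->
  (forall r, discrete_harmonic Vh k r -> '[v, r] = 0) ->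
  discrete_harmonic Vh k q ->
  Vnorm (s - sh) + Vnorm (u - uh) + `|p - ph| <=
  stability_const (`|M| * `|cP|) `|CF| *
    (Vnorm (s - t) + Vnorm (u - v) + `|p - q|).
Proof.
move=> Vt Vv vH Hq.
have [[Vs Vu [[Vp dp] _]] [eq1 eq2 _]] := sol.
have [[Vsh Vuh Hph] [eqh1 eqh2 uhH]] := solh.
have sV j (w : W j) : Vh j w -> V W j w by exact: sub_dom.
have Hq' := Hq; have Hph' := Hph.
case: Hq' => Vq dq qB; case: Hph' => Vph dph phB.
pose x := sh - t; pose y := uh - v; pose z := ph - q.
have Vx : Vh k x by exact: (submodB (Vh_submod Vh _) Vsh Vt).
have Vy : Vh (k + 1) y by exact: (submodB (Vh_submod Vh _) Vuh Vv).
have Vz : Vh (k + 1) z by exact: (submodB (Vh_submod Vh _) Vph Vq).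
have dz : 'd z = 0 by rewrite diffB ?dph ?dq ?subrr //; exact: sV.
have zB w : Vh k w -> '[z, 'd w] = 0.
  by move=> ?; rewrite innerBl phB // qB // subrr.
have yH r : discrete_harmonic Vh k r -> '[y, r] = 0.
  by move=> Hr; rewrite innerBl uhH // vH // subrr.
have yz : '[y, z] = 0 by rewrite innerBr !yH // subrr.
(* [e1] and [e2] are the error equations: both systems tested in [Vh] and subtracted, with the
   approximation errors on the right. *)
have e1 w : Vh k w -> '[y, 'd w] = '[x, w] + '[u - v, 'd w] - '[s - t, w].
  move=> Vw; have := eq1 _ (sV _ _ Vw); have := eqh1 _ Vw.
  by rewrite /x /y !innerBl; lra.
have e2 w : Vh (k + 1) w ->
    '['d x, w] + '['d y, 'd w] + '[z, w] + '[F (uh + ph) - F (u + p), w] =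
    '['d (s - t), w] + '['d (u - v), 'd w] + '[p - q, w].
  move=> Vw; have := eq2 _ (sV _ _ Vw); have := eqh2 _ Vw.
  rewrite /x /y /z !diffB //; try exact: sV.
  by rewrite !innerBl; lra.
set a := Vnorm (s - t); set b := Vnorm (u - v); set e := `|p - q|.
have a0 : 0 <= a by exact: Vnorm_ge0.
have b0 : 0 <= b by exact: Vnorm_ge0.
have e0 : 0 <= e by exact: normr_ge0.
have na : `|s - t| <= a by exact: norm_le_Vnorm.
have nb : `|u - v| <= b by exact: norm_le_Vnorm.
have da : `|'d (s - t)| <= a by exact: diff_le_Vnorm.
have db : `|'d (u - v)| <= b by exact: diff_le_Vnorm.
have VU : V W (k + 1) (u + p) by exact: (submodD (V_submod W _) Vu Vp).
have VUh : V W (k + 1) (uh + ph).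
  exact: (submodD (V_submod W _) (sV _ _ Vuh) (sV _ _ Vph)).
have VVq : V W (k + 1) (v + q).
  exact: (submodD (V_submod W _) (sV _ _ Vv) (sV _ _ Vq)).
have Vuv : V W (k + 1) (u - v).
  exact: (submodB (V_submod W _) Vu (sV _ _ Vv)).
have Vpq : V W (k + 1) (p - q).
  exact: (submodB (V_submod W _) Vp (sV _ _ Vq)).
have Vsum : V W (k + 1) ((u - v) + (p - q)).
  exact: (submodD (V_submod W _) Vuv Vpq).
have dsum : 'd ((u - v) + (p - q)) = 'd (u - v).
  rewrite diffD // (@diffB _ _ _ p q) ?dp ?dq ?subrr ?addr0 //; exact: sV.
have Vyz : V W (k + 1) (y + z).
  exact: (submodD (V_submod W _) (sV _ _ Vy) (sV _ _ Vz)).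
have dyz : 'd (y + z) = 'd y.
  by rewrite (diffD (sV _ _ Vy) (sV _ _ Vz)) dz addr0.
have lip U1 U2 : V W (k + 1) U1 -> V W (k + 1) U2 ->
    `|F U1 - F U2| <= `|CF| * (`|U1 - U2| + `|'d (U1 - U2)|).
  move=> V1 V2; apply: le_trans (lipF V1 V2) _.
  apply: le_trans (ler_wpM2r (Vnorm_ge0 _) (ler_norm CF)) _.
  by rewrite ler_wpM2l // Vnorm_le.
(* [p - q] is a cycle, so the differential sees only [u - v]; hence [2 * b + e]. *)
have FV : `|F (v + q) - F (u + p)| <= `|CF| * (2 * b + e).
  apply: le_trans (lip _ _ VVq VU) _; rewrite ler_wpM2l //.
  have -> : v + q - (u + p) = - ((u - v) + (p - q)).
    by rewrite addrACA -opprD opprB.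
  rewrite diffN // dsum !normrN; have := ler_normD (u - v) (p - q).
  by rewrite -/e; lra.
have FUh : `|F (uh + ph) - F (u + p)| <=
    `|CF| * (2 * (a + b + e) + `|y| + `|'d y| + `|z|).
  apply: le_trans (lip _ _ VUh VU) _; rewrite ler_wpM2l //.
  have -> : uh + ph - (u + p) = (y + z) - ((u - v) + (p - q)).
    rewrite opprD addrACA [in RHS]opprD [RHS]addrACA.
    by rewrite /y /z !opprB !addrA !subrK.
  have dsum' : 'd ((y + z) - ((u - v) + (p - q))) = 'd y - 'd (u - v).
    by rewrite diffB // dsum dyz.
  rewrite dsum'; have := ler_normB (y + z) ((u - v) + (p - q)).
  have := ler_normD y z; have := ler_normD (u - v) (p - q).
  have := ler_normB ('d y) ('d (u - v)).
  by rewrite -/e; lra.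
have [D DE] : exists D, D = a + b + e by exists (a + b + e).
rewrite -DE in FUh *.
have D0 : 0 <= D by rewrite DE !addr_ge0.
have aD : a <= D by lra.
have bD : b <= D by lra.
(* Test [e2] with ['d x]: the terms in ['d y] and [z] vanish. *)
have dx : `|'d x| <= D + `|CF| * (2 * D + `|y| + `|'d y| + `|z|).
  apply: norm_le_of_sqr; last by rewrite !(addr_ge0, mulr_ge0).
  have := e2 _ (sub_diff Vx); rewrite zB // diff_diff; last exact: sV.
  rewrite !inner0r -inner_norm.
  have := innerN_le_bound ('d x) FUh; have := inner_le_bound ('d x) da.
  have := inner_le_bound ('d x) (lexx e).
  have := mulr_ge0 b0 (normr_ge0 ('d x)).
  by rewrite DE !mulrDl; lra.
(* ['d w] is the discrete boundary part of [y]; testing [e1] with [w] bounds it. *)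
have [w [Vw w1 w2 w3]] := discrete_coclosed_bound Vy yH.
have dw : `|'d w| <= `|M| * `|cP| * (`|x| + D) + D.
  apply: norm_le_of_sqr; last by rewrite !(addr_ge0, mulr_ge0).
  rewrite -w2 e1 //.
  have := inner_le x w; have := inner_le_bound ('d w) (le_trans nb bD).
  have := innerN_le_bound w (le_trans na aD).
  have := ler_wpM2l (addr_ge0 (normr_ge0 x) D0) w1.
  by rewrite !mulrDl; lra.
have E : `|x| ^+ 2 + `|'d y| ^+ 2 + `|z| ^+ 2 <= D *
    (`|x| + `|'d x| + `|'d y| + (1 + 2 * `|CF|) * (`|y| + `|z|)).
  (* Test with [y + z]. By [e1] the coupling term produces ['[x, x]]; splitting at [F (v + q)]
     leaves a nonnegative monotone term and one controlled by approximation errors alone. *)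
  have := e2 _ (submodD (Vh_submod Vh _) Vy Vz).
  rewrite dyz.
  have -> : '['d x, y + z] = '[x, x] + '[u - v, 'd x] - '[s - t, x].
    by rewrite innerDr -e1 // (innerC _ z) zB // addr0 innerC.
  have -> : '[z, y + z] = '[z, z] by rewrite innerDr innerC yz add0r.
  have -> : '[F (uh + ph) - F (u + p), y + z] =
      '[F (uh + ph) - F (v + q), uh + ph - (v + q)] +
      '[F (v + q) - F (u + p), y + z].
    have -> : uh + ph - (v + q) = y + z by rewrite opprD addrACA.
    by rewrite -innerDl subrKA.
  have := monoF VUh VVq; rewrite !inner_norm.
  have := inner_le_bound x (le_trans na aD).
  have := innerN_le_bound ('d x) (le_trans nb bD).
  have := inner_le_bound ('d y) (le_trans db bD).
  have := inner_le_bound (y + z) da.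
  have := inner_le_bound (y + z) (lexx e).
  have := innerN_le_bound (y + z) FV.
  have : (a + e + `|CF| * (2 * b + e)) * `|y + z| <=
         (D * (1 + 2 * `|CF|)) * (`|y| + `|z|).
    apply: ler_pM => //; last exact: ler_normD.
      by rewrite !(addr_ge0, mulr_ge0).
    have := mulr_ge0 (normr_ge0 CF) a0; have := mulr_ge0 (normr_ge0 CF) e0.
    by rewrite DE; lra.
  by rewrite !mulrDl !mulrDr; lra.
have Y : `|y| <= `|M| * `|cP| * `|'d y| + `|M| * `|cP| * (`|x| + D) + D by lra.
have cM0 : 0 <= `|M| * `|cP| by exact: mulr_ge0.
apply: le_trans
  (energy_closure cM0 (normr_ge0 CF) D0 (normr_ge0 x) (normr_ge0 ('d y))
     (normr_ge0 z) Y dx E).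
have Es : s - sh = (s - t) - x by rewrite opprB addrA subrK.
have Eu : u - uh = (u - v) - y by rewrite opprB addrA subrK.
have Ep : p - ph = (p - q) - z by rewrite opprB addrA subrK.
have := ler_normB (p - q) z; rewrite -Ep -/e.
have := ler_normB (s - t) x; have := ler_normB (u - v) y.
have := ler_normB ('d (s - t)) ('d x); have := ler_normB ('d (u - v)) ('d y).
have dEs : 'd (s - sh) = 'd (s - t) - 'd x.
  by rewrite Es (diffB (submodB (V_submod W _) Vs (sV _ _ Vt)) (sV _ _ Vx)).
have dEu : 'd (u - uh) = 'd (u - v) - 'd y.
  by rewrite Eu (diffB Vuv (sV _ _ Vy)).
rewrite -dEs -dEu -Es -Eu; have := Vnorm_le (s - sh); have := Vnorm_le (u - uh).
by lra.
Qed.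

(** The discrete harmonic part [h] of [v] satisfies [|h| ^+ 2 = '[u, h] - '[u - v, h]], and
    [inner_discrete_harmonic] bounds the first term. *)
Lemma discrete_harmonic_approx_orthogonal (v w : W (k + 1)) :
  Vh (k + 1) v -> Vh (k + 1) w ->
  exists v', [/\ Vh (k + 1) v',
    forall r, discrete_harmonic Vh k r -> '[v', r] = 0 &
    Vnorm (u - v') <= 3 * Vnorm (u - v) + (1 + `|M|) *
      (mu Ph k * Vnorm (orth_proj (boundaries W k) u - w))].
Proof.
move=> Vv Vw; have [[_ Vu _] [_ _ uH]] := sol.
have [b [h [Bb Hh vZ]]] := discrete_hodge v.
have vH r : discrete_harmonic Vh k r -> '[v - h, r] = 0.
  move=> Hr; have := vZ _ (discrete_harmonic_cycle Hr).
  rewrite !innerBl innerDl (innerC b) (discrete_harmonic_boundary Hr Bb).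
  by rewrite add0r.
have [Vh_h dh _] := Hh.
exists (v - h); split=> //; first exact: (submodB (Vh_submod Vh _) Vv Vh_h).
have nh : `|h| <= `|u - v| + (1 + `|M|) *
    (mu Ph k * Vnorm (orth_proj (boundaries W k) u - w)).
  apply: norm_le_of_sqr.
    have := vH _ Hh; rewrite innerBl inner_norm.
    have := inner_discrete_harmonic clB bPh1 uH Hh Vw.
    have := innerN_le_bound h (lexx `|u - v|); rewrite innerBl mulrDl.
    by lra.
  by rewrite !(addr_ge0, mulr_ge0) ?(mu_ge0 bPh1) // Vnorm_ge0.
have Vuv : V W (k + 1) (u - v).
  exact: (submodB (V_submod W _) Vu (sub_dom Vv)).
rewrite opprB (addrC h) addrA.
apply: le_trans (Vnorm_le _) _.
rewrite (diffD Vuv (sub_dom Vh_h)) dh addr0.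
have := ler_normD (u - v) h; have := norm_le_Vnorm (u - v).
by have := diff_le_Vnorm (u - v); lra.
Qed.

Lemma quasi_optimal (t : W k) (v q w : W (k + 1)) :
  Vh k t -> Vh (k + 1) v -> Vh (k + 1) q -> Vh (k + 1) w ->
  Vnorm (s - sh) + Vnorm (u - uh) + `|p - ph| <=
  stability_const (`|M| * `|cP|) `|CF| * (3 * (1 + `|M|)) *
    (Vnorm (s - t) + Vnorm (u - v) + Vnorm (p - q) +
     mu Ph k * Vnorm (orth_proj (boundaries W k) u - w)).
Proof.
move=> Vt Vv Vq Vw; have [[_ _ Hp] _] := sol.
have [v' [Vv' v'H hv']] := discrete_harmonic_approx_orthogonal Vv Vw.
have [q' Hq' hq'] := discrete_harmonic_approx clB bPh1 Hp Vq.
apply: le_trans (quasi_optimal_constrained Vt Vv' v'H Hq') _.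
(* [3 * (1 + |M|)] dominates all the coefficients 1, 3 and [1 + |M|]. *)
rewrite -mulrA ler_wpM2l ?stability_const_ge0 ?mulr_ge0 //.
have m0 := normr_ge0 M.
have a0 := Vnorm_ge0 (s - t); have b0 := Vnorm_ge0 (u - v).
have e0 := Vnorm_ge0 (p - q).
have d0 := mulr_ge0 (mu_ge0 bPh1)
  (Vnorm_ge0 (orth_proj (boundaries W k) u - w)).
have := mulr_ge0 m0 a0; have := mulr_ge0 m0 b0; have := mulr_ge0 m0 e0.
by have := mulr_ge0 m0 d0; lra.
Qed.

End Stability.

(** * Quasi-optimality in terms of the infima *)

Theorem theorem4p1 (R : realType) (M : R) :
  exists C : R -> R -> R,
  forall (W : hilbert_complex R) (k : int) (I : Type)
    (Vh : I -> subcomplex W) (Ph : forall h : I, cochain_projection (Vh h))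
    (cP CF : R) (F : W (k + 1) -> W (k + 1)) (f : W (k + 1))
    (s : W k) (u p : W (k + 1))
    (sh : I -> W k) (uh ph : I -> W (k + 1)),
  closed_complex W ->
  (forall h : I, Vbounded_by (Ph h k) M) ->
  (forall h : I, Vbounded_by (Ph h (k + 1)) M) ->
  poincare_constant W k cP ->
  poincare_constant W (k + 1) cP ->
  Vmonotone F ->
  Vlipschitz F CF ->
  mixed_solution (V W k) (V W (k + 1)) (harmonic W k) F f s u p ->
  (forall h : I,
    mixed_solution (Vh h k) (Vh h (k + 1)) (discrete_harmonic (Vh h) k)
      F f (sh h) (uh h) (ph h)) ->
  forall h : I,
    Vnorm (s - sh h) + Vnorm (u - uh h) + `|p - ph h| <=
    C cP CF *
      (Vdist s (Vh h k) + Vdist u (Vh h (k + 1)) + Vdist p (Vh h (k + 1)) +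
       mu (Ph h) k *
         Vdist (orth_proj (boundaries W k) u) (Vh h (k + 1))).
Proof.
(* The hypotheses do not force [M], [cP] or [CF] to be nonnegative. *)
exists (fun cP CF => stability_const (`|M| * `|cP|) `|CF| * (3 * (1 + `|M|))).
move=> W k I Vh Ph cP CF F f s u p sh uh ph clW bPh bPh1 poinc poinc1 monoF lipF
  sol solh h.
have opt := quasi_optimal (clW k) (bPh h) (bPh1 h) poinc poinc1 monoF lipF
  sol (solh h).
set K := stability_const _ _ * _ in opt *.
have K0 : 0 <= K.
  by rewrite !(mulr_ge0, addr_ge0) ?stability_const_ge0 ?mulr_ge0.
have mu0 : 0 <= mu (Ph h) k by exact: mu_ge0 (bPh1 h).
have Vh0 j : Vh h j !=set0 by exists 0; exact: (submod0 (Vh_submod (Vh h) j)).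
(* The infima are taken one at a time, the one weighted by [mu] first. *)
rewrite !mulrDr mulrA.
apply: le_Vdist => [//||w Vw]; first exact: mulr_ge0.
rewrite -lerBlDr; apply: le_Vdist => // q Vq.
rewrite -lerBlDr; apply: le_Vdist => // v Vv.
rewrite -lerBlDr -[leRHS]add0r; apply: le_Vdist => // t Vt.
by have := opt _ _ _ _ Vt Vv Vq Vw; lra.
Qed.
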